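(* There is an algorithm which, given an $n\times n$ gray-level patch $F$, computes a best approximation of $F$ by the Parallel Stroked Multi Line (PSML) model with respect to mean squared error (that is, parameters $(\theta,G,c_1,c_2)$ minimizing the mean squared error between $F$ and the PSML image they define, over all orientations $\theta$, all binary streams $G$ and all gray levels $c_1,c_2$) in time $O(n^3 2^n)$.
   Context: Cost model: time is the number of elementary operations on a unit-cost machine with real arithmetic (arithmetic, comparison, memory access). PSML model. A patch of size $m\times n$ is a function $F:\{0,\dots,m-1\}\times\{0,\dots,n-1\}\to\mathbb{R}$; arguments are called pixels and values gray levels. The orientation is quantized: fix $C=(\lfloor m/2\rfloor,\lceil n/2\rceil)$ and let $O$ range over $D_O=\{(0,y): y=0,\dots,n-1\}\cup\{(x,n-1): x=0,\dots,m-1\}$; $\theta\in[0,\pi)$ is the angle between the line through $C$ and $O$ and the horizontal axis (arbitrary, say $0$, if $O=C$). Thus there are $m+n-1$ choices of $O$. For each orientation $\theta$, the patch is partitioned into $p=p_\theta$ nonempty parallel digital lines $u_1,\dots,u_p$ of unit width and slope $\theta$, by a fixed rasterization rule for which the index of the line containing a given pixel is computable in $O(1)$ time; the number of lines satisfies $p\le\sqrt{m^2+n^2}$. A PSML image is given by an orientation $\theta$, a binary stream $G=g_1g_2\cdots g_p\in\{0,1\}^p$ and two real gray levels $c_1,c_2$: every pixel of $u_i$ has value $c_1$ if $g_i=0$ and $c_2$ if $g_i=1$. The mean squared error between two patches is the average over all pixels of the squared difference of their gray levels. *)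

(* Defs.v *)
From HB Require Import structures.
From mathcomp Require Import all_boot all_order all_algebra.
From mathcomp Require Import all_classical all_reals all_analysis.

Set Implicit Arguments.
Unset Strict Implicit.
Unset Printing Implicit Defensive.

Import Order.TTheory GRing.Theory Num.Theory.

Local Open Scope ring_scope.

(* A patch of size m x n is a matrix F : 'M[R]_(m, n); the gray level of the pixel
   (x, y) is the entry F x y.  The first pixel coordinate is the horizontal one. *)

Section Orientation.
Variable R : realType.

(* The points O that quantize the orientations, for m, n > 0: the line through
   O and the centre C = (floor(m/2), ceil(n/2)) of the patch gives the angle. *)
Definition orientation_point (m n : nat) : pred (nat * nat) :=
  [pred o : nat * nat |
    ((o.1 == 0%N) && (o.2 < n)%N) || ((o.1 < m)%N && (o.2 == n.-1))].

(* The angle in [0, pi) of the undirected line of direction (dx, dy);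
   it is 0 when dx = dy = 0. *)
Definition line_angle (dx dy : R) : R :=
  if dy == 0 then 0
  else if dx == 0 then pi / 2
  else if atan (dy / dx) < 0 then atan (dy / dx) + pi else atan (dy / dx).

Lemma line_angleP (dx dy : R) :
  0 <= line_angle dx dy < pi /\
  dx * sin (line_angle dx dy) = dy * cos (line_angle dx dy).
Proof.
have pi0 := pi_gt0 R; rewrite /line_angle.
case: eqP => [->|/eqP dy0]; first by rewrite lexx pi0 sin0 mulr0 mul0r.
case: eqP => [->|/eqP dx0].
  rewrite mul0r cos_pihalf mulr0; split=> //; apply/andP; split.
    by rewrite divr_ge0 // ltW.
  by rewrite ltr_pdivrMr // ltr_pMr // ltr1n.
have h : dx * sin (atan (dy / dx)) = dy * cos (atan (dy / dx)).
  have := @atanK R (dy / dx); rewrite /tan.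
  have c0 : cos (atan (dy / dx)) != 0.
    by rewrite gt_eqF // cos_gt0_pihalf // atan_gtNpi2 atan_ltpi2.
  move/(congr1 (fun z => z * cos (atan (dy/dx)) * dx)).
  by rewrite divfK // mulrAC divfK // mulrC.
have u := atan_ltpi2 (dy / dx); have l := atan_gtNpi2 (dy / dx).
have hp : pi / 2 < pi :> R by rewrite ltr_pdivrMr // ltr_pMr // ltr1n.
case: ltP => a0; split=> //.
- apply/andP; split; last by rewrite gtrDr.
  by rewrite -lerBlDr sub0r ltW // (lt_trans _ l) // ltrN2.
- by rewrite sinDpi cosDpi !mulrN h.
- by rewrite a0 (lt_trans u).
Qed.

Definition orientation (m n : nat) (o : nat * nat) : R :=
  line_angle (o.1%:R - (m./2)%:R) (o.2%:R - (uphalf n)%:R).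

(* Signed distance from (x, y) to the line of angle theta through (0, 0). *)
Definition line_offset (theta : R) (x y : nat) : R :=
  y%:R * cos theta - x%:R * sin theta.

End Orientation.

(* A rasterization rule.  [line m n theta] maps a pixel to the index (counted
   from 0) of its line, among [nlines m n theta] of them.  [line_time] is the
   number of elementary operations spent to obtain that index from the size,
   the point O coding the orientation, and the pixel; it is bounded by a
   constant.

   [line_strip]: each line consists of the pixels of a strip of slope theta whose
   Euclidean width is at most 1, i.e. it is an arithmetical digital line.  The
   bound, rather than equality, leaves room for the lines clipped at the ends of
   the patch and for a unit width that is measured along an axis.  Half-open
   strips are no restriction, there being finitely many pixels. *)
Record raster (R : realType) := Raster {
  nlines : nat -> nat -> R -> nat;
  line : forall (m n : nat) (theta : R), 'I_m -> 'I_n -> 'I_(nlines m n theta);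
  line_time : nat -> nat -> nat * nat -> nat -> nat -> nat;
  line_nonempty : forall (m n : nat) (o : nat * nat),
    (0 < m)%N -> (0 < n)%N -> o \in orientation_point m n ->
    forall i : 'I_(nlines m n (orientation R m n o)),
    exists (x : 'I_m) (y : 'I_n), line (orientation R m n o) x y = i;
  line_strip : forall (m n : nat) (o : nat * nat),
    (0 < m)%N -> (0 < n)%N -> o \in orientation_point m n ->
    forall i : 'I_(nlines m n (orientation R m n o)),
    exists mu nu : R, nu <= mu + 1 /\
      forall (x : 'I_m) (y : 'I_n),
        line (orientation R m n o) x y = i <->
        mu <= line_offset (orientation R m n o) x y < nu;
  nlines_le : forall (m n : nat) (o : nat * nat),
    (0 < m)%N -> (0 < n)%N -> o \in orientation_point m n ->
    (nlines m n (orientation R m n o))%:R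
      <= Num.sqrt (m%:R ^+ 2 + n%:R ^+ 2) :> R;
  line_time_O1 : exists K : nat, forall (m n : nat) (o : nat * nat)
      (x : 'I_m) (y : 'I_n),
    o \in orientation_point m n -> (line_time m n o x y <= K)%N
}.
Arguments line {R} r {m n} theta x y.

Section Model.
Variables (R : realType) (rs : raster R).

Definition psml_image (m n : nat) (theta : R)
    (G : (nlines rs m n theta).-tuple bool) (c1 c2 : R) : 'M[R]_(m, n) :=
  \matrix_(x < m, y < n) if tnth G (line rs theta x y) then c2 else c1.

Definition mse (m n : nat) (F H : 'M[R]_(m, n)) : R :=
  (\sum_(x < m) \sum_(y < n) (F x y - H x y) ^+ 2) / (m * n)%:R.

(* The orientation is given by its point o; all the points, streams (of the
   length belonging to the point) and gray levels compete. *)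
Definition best_psml (m n : nat) (F : 'M[R]_(m, n)) (o : nat * nat)
    (G : (nlines rs m n (orientation R m n o)).-tuple bool) (c1 c2 : R) : Prop :=
  o \in orientation_point m n /\
  forall (o' : nat * nat)
    (G' : (nlines rs m n (orientation R m n o')).-tuple bool) (c1' c2' : R),
  o' \in orientation_point m n ->
  mse F (psml_image G c1 c2) <= mse F (psml_image G' c1' c2').

End Model.

(* The unit-cost machine: a while-language over two memories, one of naturals
   and one of reals.  Each memory is a family of infinite arrays indexed by nat;
   a scalar variable is a cell with a constant address.  Every constant, memory
   access, arithmetic operation, conversion, comparison and connective costs 1.
   The only literals are naturals: programs contain no arbitrary real constant.
   Angles and roundings not being elementary, the rasterization rule is a
   subroutine that is given to the machine, called by [ILine]. *)

Inductive arith_op := OpAdd | OpSub | OpMul.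

Inductive iexp :=
  | INum of nat
  | IGet of nat & iexp                 (* array name, address *)
  | IOp of arith_op & iexp & iexp.

Inductive rexp :=
  | ROfNat of iexp
  | RGet of nat & iexp                 (* array name, address *)
  | ROp of arith_op & rexp & rexp
  | RDiv of rexp & rexp.

Inductive bexp :=
  | BIle of iexp & iexp
  | BRle of rexp & rexp
  | BNot of bexp
  | BAnd of bexp & bexp.

Inductive cmd :=
  | Skip
  | ISet of nat & iexp & iexp          (* array name, address, value *)
  | RSet of nat & iexp & rexp          (* array name, address, value *)
  | ILine of nat & iexp & iexp & iexp & iexp & iexp & iexp & iexp
      (* array name, address, m, n, O (two coordinates), x, y:
         stores the index of the line of (x, y) *)
  | Seq of cmd & cmd
  | If of bexp & cmd & cmd
  | While of bexp & cmd.

Record state (R : realType) := State {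
  imem : nat -> nat -> nat;
  rmem : nat -> nat -> R
}.

Definition upd (T : Type) (f : nat -> nat -> T) (a k : nat) (v : T) :
    nat -> nat -> T :=
  fun b j => if (b == a) && (j == k) then v else f b j.

Section Machine.
Variables (R : realType) (rs : raster R).
Implicit Types (s : state R) (e : iexp) (r : rexp) (b : bexp) (c : cmd).

Definition ieval_op (op : arith_op) : nat -> nat -> nat :=
  match op with OpAdd => addn | OpSub => subn | OpMul => muln end.

Definition reval_op (op : arith_op) (u v : R) : R :=
  match op with OpAdd => u + v | OpSub => u - v | OpMul => u * v end.

Fixpoint ieval s e : nat :=
  match e with
  | INum k => k
  | IGet a e1 => imem s a (ieval s e1)
  | IOp op e1 e2 => ieval_op op (ieval s e1) (ieval s e2)
  end.

Fixpoint reval s r : R :=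
  match r with
  | ROfNat e => (ieval s e)%:R
  | RGet a e => rmem s a (ieval s e)
  | ROp op r1 r2 => reval_op op (reval s r1) (reval s r2)
  | RDiv r1 r2 => reval s r1 / reval s r2
  end.

Fixpoint beval s b : bool :=
  match b with
  | BIle e1 e2 => (ieval s e1 <= ieval s e2)%N
  | BRle r1 r2 => reval s r1 <= reval s r2
  | BNot b1 => ~~ beval s b1
  | BAnd b1 b2 => beval s b1 && beval s b2
  end.

Fixpoint icost e : nat :=
  match e with
  | INum _ => 1
  | IGet _ e1 => (icost e1).+1
  | IOp _ e1 e2 => (icost e1 + icost e2).+1
  end.

Fixpoint rcost r : nat :=
  match r with
  | ROfNat e => (icost e).+1
  | RGet _ e => (icost e).+1
  | ROp _ r1 r2 | RDiv r1 r2 => (rcost r1 + rcost r2).+1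
  end.

Fixpoint bcost b : nat :=
  match b with
  | BIle e1 e2 => (icost e1 + icost e2).+1
  | BRle r1 r2 => (rcost r1 + rcost r2).+1
  | BNot b1 => (bcost b1).+1
  | BAnd b1 b2 => (bcost b1 + bcost b2).+1
  end.

(* [exec s c t s']: started in s, the program c halts in s' after exactly t
   elementary operations.  [ILine] is stuck when its
   arguments are not an orientation point and a pixel of the patch. *)
Inductive exec : state R -> cmd -> nat -> state R -> Prop :=
  | ExecSkip s : exec s Skip 1 s
  | ExecISet s a e1 e2 :
      exec s (ISet a e1 e2) (icost e1 + icost e2).+1
        (State (upd (imem s) a (ieval s e1) (ieval s e2)) (rmem s))
  | ExecRSet s a e r :
      exec s (RSet a e r) (icost e + rcost r).+1
        (State (imem s) (upd (rmem s) a (ieval s e) (reval s r)))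
  | ExecILine s a e em en eo1 eo2 ex ey (m n : nat) (o : nat * nat)
      (x : 'I_m) (y : 'I_n) :
      ieval s em = m -> ieval s en = n ->
      (ieval s eo1, ieval s eo2) = o -> o \in orientation_point m n ->
      ieval s ex = x -> ieval s ey = y ->
      exec s (ILine a e em en eo1 eo2 ex ey)
        (icost e + icost em + icost en + icost eo1 + icost eo2 + icost ex
         + icost ey + line_time rs m n o x y).+1
        (State (upd (imem s) a (ieval s e)
                  (line rs (orientation R m n o) x y : nat)) (rmem s))
  | ExecSeq s c1 t1 s1 c2 t2 s2 :
      exec s c1 t1 s1 -> exec s1 c2 t2 s2 -> exec s (Seq c1 c2) (t1 + t2) s2
  | ExecIfT s b c1 c2 t s1 :
      beval s b -> exec s c1 t s1 -> exec s (If b c1 c2) (bcost b + t) s1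
  | ExecIfF s b c1 c2 t s1 :
      ~~ beval s b -> exec s c2 t s1 -> exec s (If b c1 c2) (bcost b + t) s1
  | ExecWhileF s b c : ~~ beval s b -> exec s (While b c) (bcost b) s
  | ExecWhileT s b c t1 s1 t2 s2 :
      beval s b -> exec s c t1 s1 -> exec s1 (While b c) t2 s2 ->
      exec s (While b c) (bcost b + t1 + t2) s2.

Lemma exec_det s c t s1 t' s1' :
  exec s c t s1 -> exec s c t' s1' -> t = t' /\ s1 = s1'.
Proof.
move=> H; elim: H t' s1' => {s c t s1}.
- by move=> s t' s' H; inversion H; subst.
- by move=> s a e1 e2 t' s' H; inversion H; subst.
- by move=> s a e r t' s' H; inversion H; subst.
- move=> s a e em en eo1 eo2 ex ey m n o x y Em En Eo Ho Ex Ey t' s' H.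
  inversion H as [| | |? ? ? ? ? ? ? ? ? m' n' o' x' y' Em' En' Eo' Ho' Ex' Ey'
    | | | | |]; subst.
  have Exx : x = x' by apply: val_inj; rewrite /= -Ex -Ex'.
  have Eyy : y = y' by apply: val_inj; rewrite /= -Ey -Ey'.
  by subst.
- move=> s c1 t1 s1 c2 t2 s2 _ IH1 _ IH2 t' s' H; inversion H; subst.
  by case: (IH1 _ _ H3) => ? ?; subst; case: (IH2 _ _ H6) => ? ?; subst.
- move=> s b c1 c2 t s1 Hb _ IH t' s' H; inversion H; subst.
    by case: (IH _ _ H7) => ? ?; subst.
  by rewrite Hb in H6.
- move=> s b c1 c2 t s1 Hb _ IH t' s' H; inversion H; subst.
    by rewrite H6 in Hb.
  by case: (IH _ _ H7) => ? ?; subst.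
- move=> s b c Hb t' s' H; inversion H; subst => //.
  by rewrite H2 in Hb.
- move=> s b c t1 s1 t2 s2 Hb _ IH1 _ IH2 t' s' H; inversion H; subst.
    by rewrite Hb in H5.
  by case: (IH1 _ _ H4) => ? ?; subst; case: (IH2 _ _ H7) => ? ?; subst.
Qed.

End Machine.

Section InputOutput.
Variables (R : realType) (rs : raster R).

(* The input: n in cell 0 of the array 0 of naturals and F, row by row, in the
   array 0 of reals.  The other cells have arbitrary contents. *)
Definition input_state (n : nat) (F : 'M[R]_n) (s : state R) : Prop :=
  imem s 0%N 0%N = n /\
  forall x y : 'I_n, rmem s 0%N (x * n + y)%N = F x y.

(* The output: O in cells 0 and 1 of the array 1 of naturals, the stream G in
   the array 2 of naturals, c1 and c2 in cells 0 and 1 of the array 1 of reals. *)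
Definition output_state (n : nat) (s : state R) (o : nat * nat)
    (G : (nlines rs n n (orientation R n n o)).-tuple bool) (c1 c2 : R) : Prop :=
  [/\ (imem s 1%N 0%N, imem s 1%N 1%N) = o,
      forall i, imem s 2%N (nat_of_ord i) = nat_of_bool (tnth G i),
      rmem s 1%N 0%N = c1 & rmem s 1%N 1%N = c2].

End InputOutput.

(* Main.v *)
Require Import Defs.
From mathcomp Require Import all_boot all_order all_algebra.
From mathcomp Require Import all_classical all_reals all_analysis.
From mathcomp Require Import zify ring lra.

(* For a fixed orientation let the line i have N_i pixels of total gray level S_i.
   Up to a constant, the squared error of levels c is the sum over i of
   N_i c^2 - 2 c S_i, where c is the level given to the line i.
   So for fixed levels it is optimal to give the higher level exactly
   to the lines whose mean S_i / N_i passes a threshold, which can be taken to be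
   the mean of a line; for a fixed stream the class means are the optimal levels.
   There are at most 2n orientations with at most 2n lines each, so trying every
   line as threshold takes time O(n) for each pair (orientation, line), after
   the sums of the orientation have been computed in time O(n^2).  The total is
   O(n^3), well within O(n^3 2^n). *)

Import Order.TTheory GRing.Theory Num.Theory.

(** * Total-correctness rules with time bounds *)

Fixpoint iwrites (c : cmd) : seq nat :=
  match c with
  | Skip | RSet _ _ _ => [::]
  | ISet a _ _ | ILine a _ _ _ _ _ _ _ => [:: a]
  | Seq c1 c2 | If _ c1 c2 => iwrites c1 ++ iwrites c2
  | While _ c1 => iwrites c1
  end.

Fixpoint rwrites (c : cmd) : seq nat :=
  match c with
  | Skip | ISet _ _ _ | ILine _ _ _ _ _ _ _ _ => [::]
  | RSet a _ _ => [:: a]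
  | Seq c1 c2 | If _ c1 c2 => rwrites c1 ++ rwrites c2
  | While _ c1 => rwrites c1
  end.

Definition ivar (a : nat) : iexp := IGet a (INum 0).
Definition rvar (a : nat) : rexp := RGet a (INum 0).

(* The counter is the array v; the bound is c n, with n read from the input cell. *)
Definition for_loop (v c : nat) (body : cmd) : cmd :=
  Seq (ISet v (INum 0) (INum 0))
      (While (BNot (BIle (IOp OpMul (INum c) (ivar 0)) (ivar v)))
         (Seq body (ISet v (INum 0) (IOp OpAdd (ivar v) (INum 1))))).

Section Runs.
Variables (R : realType) (rs : raster R).
Implicit Types (s : state R) (c : cmd) (Q : state R -> Prop).

(** Since execution is deterministic, the existence of one run is total correctness. *)
Definition runs s c (T : nat) Q : Prop :=
  exists t s', [/\ exec rs s c t s', (t <= T)%N & Q s'].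

Definition frame c s s' : Prop :=
  (forall a, a \notin iwrites c -> imem s' a = imem s a) /\
  (forall a, a \notin rwrites c -> rmem s' a = rmem s a).

Definition iupd s a k v := State (upd (imem s) a k v) (rmem s).
Definition rupd s a k (v : R) := State (imem s) (upd (rmem s) a k v).

Lemma upd_other (V : Type) (f : nat -> nat -> V) a k v b :
  b \notin [:: a] -> upd f a k v b = f b.
Proof.
by rewrite inE => /negbTE nab; apply/funext => j; rewrite /upd nab.
Qed.

Lemma exec_frame s c t s' : exec rs s c t s' -> frame c s s'.
Proof.
elim=> {s c t s'} //=.
- by move=> s a e1 e2; split=> b hb //=; rewrite upd_other.
- by move=> s a e r; split=> b hb //=; rewrite upd_other.
- by move=> *; split=> b hb //=; rewrite upd_other.
- move=> s c1 t1 s1 c2 t2 s2 _ [i1 r1] _ [i2 r2].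
  by split=> a; rewrite mem_cat negb_or => /andP[h1 h2]; rewrite ?i2 ?r2 ?i1 ?r1.
- move=> s b c1 c2 t s1 _ _ [i1 r1].
  by split=> a; rewrite mem_cat negb_or => /andP[h1 h2]; rewrite ?i1 ?r1.
- move=> s b c1 c2 t s1 _ _ [i1 r1].
  by split=> a; rewrite mem_cat negb_or => /andP[h1 h2]; rewrite ?i1 ?r1.
- move=> s b c t1 s1 t2 s2 _ _ [i1 r1] _ [i2 r2].
  by split=> a h; rewrite ?i2 ?r2 ?i1 ?r1.
Qed.

Lemma frame_trans c s1 s2 s3 : frame c s1 s2 -> frame c s2 s3 -> frame c s1 s3.
Proof. by move=> [i1 r1] [i2 r2]; split=> a h; rewrite ?i2 ?r2 ?i1 ?r1. Qed.

(** Every run satisfies the frame condition of its command, so postconditions and invariants need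
    not mention arrays that are never written. *)
Lemma runs_weaken s c (T T' : nat) Q Q' :
  runs s c T Q -> (T <= T')%N -> (forall s', frame c s s' -> Q s' -> Q' s') ->
  runs s c T' Q'.
Proof.
move=> [t [s' [e le_t q]]] le_T QQ'; exists t, s'.
by split; [|exact: leq_trans le_T|exact/QQ'/q/(exec_frame _ _ _ _ e)].
Qed.

Lemma runs_leq s c (T T' : nat) Q :
  (T <= T')%N -> runs s c T Q -> runs s c T' Q.
Proof. by move=> le_T r; exact: runs_weaken r le_T _. Qed.

(** The run of [c2] is itself the postcondition of [c1], so that a program is verified by stepping
    forward through it. *)
Lemma runs_seq s c1 c2 T1 T2 Q :
  runs s c1 T1 (fun s1 => frame c1 s s1 -> runs s1 c2 T2 Q) ->
  runs s (Seq c1 c2) (T1 + T2) Q.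
Proof.
move=> [t1 [s1 [e1 le1 /(_ (exec_frame _ _ _ _ e1)) [t2 [s2 [e2 le2 q]]]]]].
by exists (t1 + t2)%N, s2; split; [exact: ExecSeq e1 e2|exact: leq_add|].
Qed.

Lemma runs_skip s Q : Q s -> runs s Skip 1 Q.
Proof. by exists 1%N, s; split=> //; exact: ExecSkip. Qed.

Lemma runs_iset s a e1 e2 Q :
  Q (iupd s a (ieval s e1) (ieval s e2)) ->
  runs s (ISet a e1 e2) (icost e1 + icost e2).+1 Q.
Proof. by move=> q; do 2!eexists; split; [exact: ExecISet| |exact: q]. Qed.

Lemma runs_rset s a e r Q :
  Q (rupd s a (ieval s e) (reval s r)) ->
  runs s (RSet a e r) (icost e + rcost r).+1 Q.
Proof. by move=> q; do 2!eexists; split; [exact: ExecRSet| |exact: q]. Qed.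

Lemma runs_if s b c1 c2 T Q :
  (beval s b -> runs s c1 T Q) -> (~~ beval s b -> runs s c2 T Q) ->
  runs s (If b c1 c2) (bcost b + T) Q.
Proof.
move=> h1 h2; case: (boolP (beval s b)) => hb.
- have [t [s' [e le_t q]]] := h1 hb; exists (bcost b + t)%N, s'.
  by split; [exact: ExecIfT|rewrite leq_add2l|].
- have [t [s' [e le_t q]]] := h2 hb; exists (bcost b + t)%N, s'.
  by split; [exact: ExecIfF|rewrite leq_add2l|].
Qed.

(** The overhead 14 per round is 8 for the guard and 6 for the increment; the final 11 is 3 for the
    initialization and 8 for the failing guard. The invariant has to survive writes to the counter,
    whose value is supplied separately. *)
Lemma runs_for (v c : nat) (body : cmd) (n T : nat)
    (I : nat -> state R -> Prop) s :
  imem s 0%N 0%N = n -> 0%N \notin v :: iwrites body -> v \notin iwrites body ->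
  (forall i s' w, I i s' -> I i (iupd s' v 0 w)) ->
  I 0%N s ->
  (forall i s', (i < c * n)%N -> imem s' v 0%N = i ->
     frame (for_loop v c body) s s' -> I i s' -> runs s' body T (I i.+1)) ->
  runs s (for_loop v c body) (c * n * (T + 14) + 11) (I (c * n)%N).
Proof.
move=> sn; rewrite inE negb_or => /andP[v0 n0] vb stable I0 step.
(* The induction is on the number [m] of rounds still to come. *)
have loop m i s1 : (i + m = c * n)%N -> imem s1 v 0%N = i ->
    frame (for_loop v c body) s s1 -> I i s1 ->
    exists t s2, [/\ exec rs s1 (While (BNot (BIle (IOp OpMul (INum c) (ivar 0))
        (ivar v))) (Seq body (ISet v (INum 0) (IOp OpAdd (ivar v) (INum 1))))) t s2,
      (t <= m * (T + 14) + 8)%N & I (c * n)%N s2].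
  elim: m i s1 => [|m IH] i s1 im iv fr Ii.
    exists 8%N, s1; split=> //; last by rewrite -im addn0.
    apply: ExecWhileF; rewrite /= fr.1; last first.
      by rewrite inE mem_cat inE negb_or v0 negb_or n0.
    by rewrite sn iv -im addn0 leqnn.
  have in_n : (i < c * n)%N by rewrite -im addnS ltnS leq_addr.
  have [t [s2 [e2 le_t I2]]] := step i s1 in_n iv fr Ii.
  have fr2 := exec_frame _ _ _ _ e2.
  have iv2 : imem s2 v 0%N = i by rewrite fr2.1.
  pose s3 := iupd s2 v 0 i.+1.
  have e3 : exec rs s1
      (Seq body (ISet v (INum 0) (IOp OpAdd (ivar v) (INum 1)))) (t + 6) s3.
    apply: ExecSeq e2 _.
    have := ExecISet rs s2 v (INum 0) (IOp OpAdd (ivar v) (INum 1)).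
    by rewrite /= iv2 (addn1 i).
  have fr3 : frame (for_loop v c body) s1 s3.
    have [i3 r3] := exec_frame _ _ _ _ e3.
    split=> a; last exact: r3.
    by rewrite /= inE negb_or => /andP[_]; exact: i3.
  have [t4 [s4 [e4 le4 I4]]] : exists t s4, [/\ exec rs s3 (While (BNot (BIle
        (IOp OpMul (INum c) (ivar 0)) (ivar v)))
        (Seq body (ISet v (INum 0) (IOp OpAdd (ivar v) (INum 1))))) t s4,
      (t <= m * (T + 14) + 8)%N & I (c * n)%N s4].
    apply: (IH i.+1); first by rewrite addSnnS.
    - by rewrite /s3 /= /upd !eqxx.
    - exact: frame_trans fr3.
    - exact: stable.
  exists (8 + (t + 6) + t4)%N, s4; split=> //; last by lia.
  apply: ExecWhileT e3 e4; rewrite /= fr.1; last first.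
    by rewrite inE mem_cat inE negb_or v0 negb_or n0.
  by rewrite sn iv -ltnNge.
have [||||t [s' [e le_t q]]] := loop (c * n)%N 0%N (iupd s v 0 0).
- by [].
- by rewrite /= /upd !eqxx.
- split=> a; rewrite /= ?inE ?negb_or // => /andP[av _].
  by rewrite upd_other ?inE.
- exact: stable.
exists (3 + t)%N, s'; split=> //; last by lia.
exact: ExecSeq (ExecISet rs s v (INum 0) (INum 0)) e.
Qed.

End Runs.

(** * Optimal two-level approximation of weighted lines *)

Section TwoMeans.
Local Open Scope ring_scope.
Variables (R : realFieldType) (I : finType) (N S : I -> R).
Hypothesis N_ge0 : forall i, 0 <= N i.
Hypothesis S_eq0 : forall i, N i = 0 -> S i = 0.

Definition class_sum (f : I -> R) (g : I -> bool) (b : bool) : R :=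
  \sum_(i | g i == b) f i.

Definition class_mean (g : I -> bool) (b : bool) : R :=
  class_sum S g b / class_sum N g b.

(** With class weights M and class sums T this is the sum of T^2 / M, the largest decrease of the
    squared error that the stream [g] permits. *)
Definition score (g : I -> bool) : R :=
  \sum_b class_mean g b * class_sum S g b.

Definition cost (g : I -> bool) (c : bool -> R) : R :=
  \sum_i (N i * c (g i) ^+ 2 - c (g i) * S i *+ 2).

Definition threshold (j i : I) : bool := S j / N j <= S i / N i.

Lemma class_sum_ge0 g b : 0 <= class_sum N g b.
Proof. exact: sumr_ge0. Qed.

Lemma class_sum_eq0 g b : class_sum N g b = 0 -> class_sum S g b = 0.
Proof.
move=> N0; apply: big1 => i gi; apply: S_eq0.
by apply: (psumr_eq0P _ N0) => // k _; exact: N_ge0.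
Qed.

Lemma cost_class g c :
  cost g c = \sum_b (class_sum N g b * c b ^+ 2 - c b * class_sum S g b *+ 2).
Proof.
rewrite /cost (partition_big g predT) //=; apply: eq_bigr => b _.
rewrite mulr_suml mulr_sumr -sumrMnl -sumrB.
by apply: eq_bigr => i /eqP ->.
Qed.

(** Completing the square in each class leaves M (c - T / M)^2; a class of weight 0 also has sum 0
    and contributes 0 to both sides. *)
Lemma cost_ge g c : - score g <= cost g c.
Proof.
rewrite cost_class /score -sumrN; apply: ler_sum => b _.
rewrite /class_mean; have := class_sum_ge0 g b; have := @class_sum_eq0 g b.
move: (class_sum N g b) (class_sum S g b) => M T MT M0.
have [M00|Mn0] := eqVneq M 0; first by rewrite (MT M00) M00; lra.
rewrite -subr_ge0.
have -> : M * c b ^+ 2 - c b * T *+ 2 - - (T / M * T) = M * (c b - T / M) ^+ 2.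
  by field.
by rewrite mulr_ge0 ?sqr_ge0.
Qed.

Lemma cost_mean g : cost g (class_mean g) = - score g.
Proof.
rewrite cost_class /score -sumrN; apply: eq_bigr => b _; rewrite /class_mean.
have [M00|Mn0] := eqVneq (class_sum N g b) 0; last by field.
by rewrite (class_sum_eq0 _ _ M00) M00; ring.
Qed.

Lemma score_ge0 g : 0 <= score g.
Proof.
apply: sumr_ge0 => b _.
by rewrite mulrAC divr_ge0 ?class_sum_ge0 // -expr2 sqr_ge0.
Qed.

(* For fixed gray levels u <= v, giving v to the lines whose mean is at least
   (u + v) / 2 is optimal; the least such mean is the threshold. *)
Lemma threshold_optimal (i0 : I) g c : exists j, - score (threshold j) <= cost g c.
Proof.
pose u := Num.min (c false) (c true); pose v := Num.max (c false) (c true).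
have uv : u <= v by rewrite /u /v; case: (leP (c false)) => // /ltW.
have cuv b : c b = u \/ c b = v.
  by rewrite /u /v; case: (leP (c false)); case: b; auto.
pose high i := (0 < N i) && ((u + v) / 2 <= S i / N i).
(* Any levels [c'] may accompany the threshold stream, since [cost_ge] puts minus its score below
   their cost. *)
suff [j [c' le_c]] : exists j c', cost (threshold j) c' <= cost g c.
  by exists j; exact: le_trans (cost_ge _ _) le_c.
have [i1 high1|low] := pickP high; last first.
  (* No line prefers the higher level, so the constant level [u] is optimal whatever the
     threshold. *)
  exists i0, (fun=> u); apply: ler_sum => i _.
  have [Ni0|Nin0] := eqVneq (N i) 0; first by rewrite S_eq0 // Ni0; lra.
  have Ni : 0 < N i by rewrite lt_neqAle eq_sym Nin0 N_ge0.
  have := low i; rewrite /high Ni /= => /negbT; rewrite -ltNge ltr_pdivrMr //.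
  by case: (cuv (g i)) => ->; nra.
case: (Order.TotalTheory.arg_minP (fun i => S i / N i) high1) => j highj minj.
exists j, (fun b => if b then v else u); apply: ler_sum => i _.
have [Ni0|Nin0] := eqVneq (N i) 0; first by rewrite S_eq0 // Ni0; lra.
have Ni : 0 < N i by rewrite lt_neqAle eq_sym Nin0 N_ge0.
have -> : threshold j i = high i.
  apply/idP/idP => [ji|]; last exact: minj.
  by rewrite /high Ni; apply: le_trans ji; case/andP: highj.
rewrite /high Ni /= ler_pdivlMr //.
by case: (leP ((u + v) / 2 * N i)) => hi; case: (cuv (g i)) => ->; nra.
Qed.

End TwoMeans.

Lemma sum_lt_succ (V : nmodType) (n : nat) (i : 'I_n) (P : pred 'I_n) (f : 'I_n -> V) :
  (\sum_(j : 'I_n | (j < i.+1)%N && P j) f j =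
   \sum_(j : 'I_n | (j < i)%N && P j) f j + (if P i then f i else 0))%R.
Proof.
rewrite big_mkcondr (bigD1 i) ?leqnn //= addrC; congr (_ + _)%R.
rewrite [RHS]big_mkcondr; apply: eq_bigl => j.
by rewrite ltnS [RHS]ltn_neqAle andbC.
Qed.

(** Labels are plain naturals, so that an index past the last line is legal and gets the empty
    sum. *)
Definition bucket (R : realType) (n : nat) (l : 'I_n -> 'I_n -> nat)
    (f : 'I_n -> 'I_n -> R) (i : nat) : R :=
  (\sum_x \sum_(y | l x y == i) f x y)%R.

(** * The program *)

(* By truncated subtraction this is (0, k) if k < n, and (k - n, n - 1) if not. *)
Definition opoint (n k : nat) : nat * nat := (k - n, k - (k - (n - 1)))%N.

(* Arrays of naturals: 3 and 4 hold the orientation index k and the threshold line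
   j, 5 to 7 the loop counters, 8 the line of the current pixel, 9 and 10 the best
   k and j so far.  Arrays of reals: 2 and 3 hold S and N, 4 and 5 their sums over
   the two classes, 6 the score of (k, j), 7 the best score.  The number of lines
   is unknown to the machine: all arrays indexed by lines have 2n entries, the
   entries past the last line having S = N = 0 and hence, as 0 / 0 = 0, mean 0. *)
Definition pixel_step : cmd :=
  Seq (ILine 8 (INum 0) (ivar 0) (ivar 0) (ivar 1) (IGet 1 (INum 1)) (ivar 6) (ivar 7))
 (Seq (RSet 2 (ivar 8) (ROp OpAdd (RGet 2 (ivar 8))
        (RGet 0 (IOp OpAdd (IOp OpMul (ivar 6) (ivar 0)) (ivar 7)))))
      (RSet 3 (ivar 8) (ROp OpAdd (RGet 3 (ivar 8)) (ROfNat (INum 1))))).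

Definition line_sums : cmd :=
  Seq (ISet 1 (INum 0) (IOp OpSub (ivar 3) (ivar 0)))
 (Seq (ISet 1 (INum 1) (IOp OpSub (ivar 3) (IOp OpSub (ivar 3)
        (IOp OpSub (ivar 0) (INum 1)))))
 (Seq (for_loop 5 2 (Seq (RSet 2 (ivar 5) (ROfNat (INum 0)))
                         (RSet 3 (ivar 5) (ROfNat (INum 0)))))
      (for_loop 6 1 (for_loop 7 1 pixel_step)))).

Definition mean_exp (v : nat) : rexp := RDiv (RGet 2 (ivar v)) (RGet 3 (ivar v)).

(** The bit stored for the line doubles as the address of the class accumulators. *)
Definition class_step : cmd :=
  Seq (If (BRle (mean_exp 4) (mean_exp 5))
          (ISet 2 (ivar 5) (INum 1)) (ISet 2 (ivar 5) (INum 0)))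
 (Seq (RSet 4 (IGet 2 (ivar 5))
        (ROp OpAdd (RGet 4 (IGet 2 (ivar 5))) (RGet 2 (ivar 5))))
      (RSet 5 (IGet 2 (ivar 5))
        (ROp OpAdd (RGet 5 (IGet 2 (ivar 5))) (RGet 3 (ivar 5))))).

Definition split_lines : cmd :=
  Seq (RSet 4 (INum 0) (ROfNat (INum 0)))
 (Seq (RSet 4 (INum 1) (ROfNat (INum 0)))
 (Seq (RSet 5 (INum 0) (ROfNat (INum 0)))
 (Seq (RSet 5 (INum 1) (ROfNat (INum 0)))
 (Seq (for_loop 5 2 class_step)
 (Seq (RSet 1 (INum 0) (RDiv (rvar 4) (rvar 5)))
 (Seq (RSet 1 (INum 1) (RDiv (RGet 4 (INum 1)) (RGet 5 (INum 1))))
      (RSet 6 (INum 0)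
        (ROp OpAdd (ROp OpMul (RGet 1 (INum 1)) (RGet 4 (INum 1)))
                   (ROp OpMul (rvar 1) (rvar 4))))))))))%R.

Definition keep_best : cmd :=
  If (BNot (BRle (rvar 6) (rvar 7)))
    (Seq (RSet 7 (INum 0) (rvar 6))
    (Seq (ISet 9 (INum 0) (ivar 3)) (ISet 10 (INum 0) (ivar 4)))) Skip.

(** The search keeps only the indices of the best pair; the last four commands recompute its stream
    and levels. *)
Definition psml_prog : cmd :=
  Seq (RSet 7 (INum 0) (ROfNat (INum 0)))
 (Seq (ISet 9 (INum 0) (INum 0))
 (Seq (ISet 10 (INum 0) (INum 0))
 (Seq (for_loop 3 2 (Seq line_sums (for_loop 4 2 (Seq split_lines keep_best))))
 (Seq (ISet 3 (INum 0) (ivar 9))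
 (Seq line_sums
 (Seq (ISet 4 (INum 0) (ivar 10))
      split_lines)))))).

(** * Correctness of the program *)

Section Program.
Variables (R : realType) (rs : raster R).
Implicit Types s : state R.

Lemma runs_iline s a e em en eo1 eo2 ex ey (m n : nat) (o : nat * nat)
    (x : 'I_m) (y : 'I_n) (K : nat) Q :
  ieval s em = m -> ieval s en = n ->
  (ieval s eo1, ieval s eo2) = o -> o \in orientation_point m n ->
  ieval s ex = x -> ieval s ey = y -> (line_time rs m n o x y <= K)%N ->
  Q (iupd R s a (ieval s e) (line rs (orientation R m n o) x y)) ->
  runs R rs s (ILine a e em en eo1 eo2 ex ey)
    (icost e + icost em + icost en + icost eo1 + icost eo2 + icost ex + icost ey
     + K).+1 Q.
Proof.
move=> hm hn ho hp hx hy le_K q; do 2!eexists; split; last exact: q.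
  exact: (ExecILine rs a e hm hn ho hp hx hy).
by rewrite ltnS leq_add2l.
Qed.

Lemma opoint_in n k : (0 < n)%N -> (k < 2 * n)%N ->
  opoint n k \in orientation_point n n.
Proof. by rewrite /opoint inE /=; lia. Qed.

(** The point [(0, y)] has index [y] and [(x, n - 1)] has index [n + x]; the corner [(0, n - 1)] is
    thus tried twice. *)
Lemma opoint_onto n o : o \in orientation_point n n ->
  exists k : 'I_(2 * n), o = opoint n k.
Proof.
case: o => o1 o2; rewrite inE /= => /orP[/andP[/eqP -> h]|/andP[h /eqP ->]].
  have lt_k : (o2 < 2 * n)%N by lia.
  by exists (Ordinal lt_k); rewrite /opoint /=; congr pair; lia.
have lt_k : (n + o1 < 2 * n)%N by lia.
by exists (Ordinal lt_k); rewrite /opoint /=; congr pair; lia.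
Qed.

Definition pline n k (x y : 'I_n) : nat :=
  line rs (orientation R n n (opoint n k)) x y.

Section Patch.
Variables (n : nat) (F : 'M[R]_n) (KL : nat).
Hypothesis n_gt0 : (0 < n)%N.
Hypothesis KL_bound : forall (o : nat * nat) (x y : 'I_n),
  o \in orientation_point n n -> (line_time rs n n o x y <= KL)%N.

Definition gray_sum (k : nat) (i : 'I_(2 * n)) : R := bucket R n (pline n k) F i.
Definition pixel_count (k : nat) (i : 'I_(2 * n)) : R :=
  bucket R n (pline n k) (fun _ _ => 1%R) i.

(** The diagonal satisfies n^2 + n^2 <= (2n)^2. Hence arrays of 2n entries hold all lines of every
    orientation. *)
Lemma nlines_le_2n k : (k < 2 * n)%N ->
  (nlines rs n n (orientation R n n (opoint n k)) <= 2 * n)%N.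
Proof.
move=> k_lt; rewrite -(ler_nat R).
apply: le_trans (nlines_le rs n_gt0 n_gt0 (opoint_in n k n_gt0 k_lt)) _.
have -> : ((2 * n)%:R = Num.sqrt ((2 * n)%:R ^+ 2) :> R)%R.
  by rewrite sqrtr_sqr normr_nat.
rewrite ler_sqrt ?sqr_ge0 // natrM exprMn.
by have := sqr_ge0 (n%:R : R); lra.
Qed.

Lemma line_sums_runs s k : input_state F s -> imem s 3 0 = k -> (k < 2 * n)%N ->
  runs R rs s line_sums ((KL + 300) * n ^ 2) (fun s' =>
    [/\ (imem s' 1 0, imem s' 1 1) = opoint n k,
        forall i : 'I_(2 * n), rmem s' 2 i = gray_sum k i
      & forall i : 'I_(2 * n), rmem s' 3 i = pixel_count k i]).
Proof.
move=> [sn sF] sk k_lt.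
(* The accumulators hold the completed values [x' < x] plus an initial part of the current one;
   [&& true] gives the sum the shape of [sum_lt_succ]. *)
pose line_partial (f : 'I_n -> 'I_n -> R) (x : nat) (i : 'I_(2 * n)) : R :=
  (\sum_(x' : 'I_n | (x' < x)%N && true) \sum_(y | pline n k x' y == i) f x' y)%R.
pose pixel_partial (f : 'I_n -> 'I_n -> R) (x : 'I_n) (y : nat) (i : 'I_(2 * n)) : R :=
  (\sum_(y' : 'I_n | (y' < y)%N && (pline n k x y' == i)) f x y')%R.
pose outer x s1 := forall i : 'I_(2 * n),
  rmem s1 2 i = line_partial F x i /\ rmem s1 3 i = line_partial (fun _ _ => 1%R) x i.
pose inner (x : 'I_n) y s1 := forall i : 'I_(2 * n),
  rmem s1 2 i = (line_partial F x i + pixel_partial F x y i)%R /\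
  rmem s1 3 i = (line_partial (fun _ _ => 1) x i + pixel_partial (fun _ _ => 1) x y i)%R.
eapply runs_weaken.
- apply: runs_seq; apply: runs_iset => _.
  apply: runs_seq; apply: runs_iset => _.
  apply: runs_seq.
  apply: runs_weaken (leqnn _) _.
    apply: (runs_for R rs 5 2 _ n 20 (fun t s1 => forall i, (i < t)%N ->
      rmem s1 2 i = 0%R /\ rmem s1 3 i = 0%R)) => //.
    move=> t s1 _ s1t _ It; eapply runs_weaken.
    + apply: runs_seq; apply: runs_rset => _; apply: runs_rset.
      exact: erefl.
    + by [].
    + move=> s2 _ <- i; rewrite ltnS leq_eqVlt /= /upd /= s1t.
      by case: eqVneq => //= _ /It.
  move=> s1 fr1 zero _.
  have n1 : imem s1 0 0 = n by rewrite fr1.1.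
  have o1 : (imem s1 1 0, imem s1 1 1) = opoint n k.
    by rewrite fr1.1 //= /upd /= sk sn.
  have r1 : rmem s1 0%N = rmem s 0%N by rewrite fr1.2.
  apply: (runs_weaken _ _ _ _ _ _ (outer (1 * n)%N) (fun s' =>
    (imem s' 1 0, imem s' 1 1) = opoint n k /\ outer (1 * n)%N s') _ (leqnn _));
    last by move=> s2 fr2; rewrite fr2.1.
  apply: (runs_for R rs 6 1 _ n (1 * n * (KL + 60 + 14) + 11)%N outer) => //.
    by move=> i; rewrite /line_partial /= !big_pred0 //; exact: zero.
  move=> x s2; rewrite mul1n => x_lt s2x fr2 out.
  pose xo := Ordinal x_lt.
  eapply runs_weaken.
  + apply: (runs_for R rs 7 1 pixel_step n (KL + 60) (inner xo)) => //.
    * by rewrite fr2.1.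
    * move=> i; have [-> ->] := out i.
      by rewrite /pixel_partial !big_pred0 ?addr0 // => j.
    move=> y s3; rewrite mul1n => y_lt s3y fr3 inn.
    pose yo := Ordinal y_lt.
    have n3 : imem s3 0 0 = n by rewrite fr3.1 // fr2.1.
    have o3 : (imem s3 1 0, imem s3 1 1) = opoint n k by rewrite fr3.1 // fr2.1.
    have r3 : rmem s3 0 = rmem s 0 by rewrite fr3.2 // fr2.2.
    have x3 : imem s3 6 0 = x by rewrite fr3.1.
    eapply runs_weaken.
    * apply: runs_seq.
      apply: (runs_iline _ _ _ _ _ _ _ _ _ n n (opoint n k) xo yo KL) => //=.
      -- exact: opoint_in.
      -- by apply: (KL_bound _ xo yo); exact: opoint_in.
      move=> _; apply: runs_seq; apply: runs_rset => _; apply: runs_rset.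
      exact: erefl.
    * by rewrite /=; lia.
    * move=> s4 _ <- i /=; have [iF i1] := inn i.
      rewrite /pixel_partial !(sum_lt_succ _ n yo) !addrA -iF -i1.
      rewrite /upd /= n3 x3 s3y r3 (sF xo yo).
      rewrite -/(pline n k xo yo) eq_sym.
      by case: eqVneq => [->|]; rewrite ?addr0.
  + by rewrite mul1n.
  + move=> s3 _ inn i; have [-> ->] := inn i; rewrite mul1n.
    rewrite /line_partial !(sum_lt_succ _ n xo) /pixel_partial; split; congr (_ + _)%R;
      by apply: eq_bigl => j; rewrite ltn_ord.
- by rewrite /=; nia.
- move=> s1 _ [points out]; split=> //.
  + move=> i; have [-> _] := out i; rewrite mul1n; apply: eq_bigl => j.
    by rewrite ltn_ord.
  + move=> i; have [_ ->] := out i; rewrite mul1n; apply: eq_bigl => j.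
    by rewrite ltn_ord.
Qed.

Lemma split_lines_runs s (N S : 'I_(2 * n) -> R) (j : 'I_(2 * n)) :
  imem s 0 0 = n -> imem s 4 0 = j ->
  (forall i : 'I_(2 * n), rmem s 2 i = S i) ->
  (forall i : 'I_(2 * n), rmem s 3 i = N i) ->
  runs R rs s split_lines (300 * n) (fun s' =>
    [/\ forall i : 'I_(2 * n), imem s' 2 i = threshold R _ N S j i :> nat,
        forall b : bool, rmem s' 1 b = class_mean R _ N S (threshold R _ N S j) b
      & rmem s' 6 0 = score R _ N S (threshold R _ N S j)]).
Proof.
move=> sn sj sS sN; set g := threshold R _ N S j.
pose partial (f : 'I_(2 * n) -> R) (t : nat) (b : bool) : R :=
  (\sum_(i : 'I_(2 * n) | (i < t)%N && (g i == b)) f i)%R.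
pose inv (t : nat) s1 := [/\ forall i : 'I_(2 * n), (i < t)%N -> imem s1 2 i = g i :> nat,
  forall b : bool, rmem s1 4 b = partial S t b
  & forall b : bool, rmem s1 5 b = partial N t b].
eapply runs_leq; last first.
- do 4!(apply: runs_seq; apply: runs_rset => _).
  apply: runs_seq; apply: runs_weaken (leqnn _) _.
    apply: (runs_for R rs 5 2 class_step n 60 inv) => //.
      by split=> // b; rewrite /partial big_pred0 //; case: b; rewrite /= /upd.
    move=> i s1 i_lt s1i fr [sg s4 s5].
    pose io := Ordinal i_lt.
    have s1j : imem s1 4 0 = j by rewrite fr.1.
    have s1S (l : 'I_(2 * n)) : rmem s1 2 l = S l by rewrite fr.2 //; exact: sS.
    have s1N (l : 'I_(2 * n)) : rmem s1 3 l = N l by rewrite fr.2 //; exact: sN.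
    have guard : beval s1 (BRle (mean_exp 4) (mean_exp 5)) = g io.
      by rewrite /= s1j s1i !s1S !s1N (s1S io) (s1N io).
    eapply runs_weaken.
    + apply: runs_seq.
      (* Both branches end in the state that stores the bit [g io], so the remaining commands are
         verified only once. *)
      apply: (runs_weaken R rs _ _ _ _ (eq (iupd R s1 2 i (g io))) _ _ (leqnn _)).
        apply: (runs_if R rs _ _ _ _ 4); rewrite guard => gi.
          by apply: runs_iset; rewrite /= s1i gi.
        by apply: runs_iset; rewrite /= s1i (negbTE gi).
      move=> _ _ <- _.
      apply: runs_seq; apply: runs_rset => _; apply: runs_rset.
      exact: erefl.
    + by rewrite /=; lia.
    + move=> s2 _ <-; rewrite /= /upd /= s1i !eqxx.
      split=> [l|b|b].
      * rewrite ltnS leq_eqVlt /= /upd /=.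
        case: (eqVneq (l : nat) i) => [li _|_ /sg //].
        by have -> : l = io by exact: val_inj.
      * rewrite /partial (sum_lt_succ _ _ io) -/(partial S i b) -s4 /= /upd /= (s1S io).
        by case: b; case: (g io); rewrite //= addr0.
      * rewrite /partial (sum_lt_succ _ _ io) -/(partial N i b) -s5 /= /upd /= (s1N io).
        by case: b; case: (g io); rewrite //= addr0.
  move=> s1 _ [sg s4 s5] _.
  do 2!(apply: runs_seq; apply: runs_rset => _); apply: runs_rset.
  have full f b : partial f (2 * n)%N b = class_sum R _ f g b.
    by apply: eq_bigl => i; rewrite ltn_ord.
  have T0 : rmem s1 4 0 = class_sum R _ S g false by rewrite -full -s4.
  have T1 : rmem s1 4 1 = class_sum R _ S g true by rewrite -full -s4.
  have M0 : rmem s1 5 0 = class_sum R _ N g false by rewrite -full -s5.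
  have M1 : rmem s1 5 1 = class_sum R _ N g true by rewrite -full -s5.
  split=> [i|b|]; first by rewrite /= sg.
    by case: b; rewrite /= /upd /= /class_mean ?T0 ?T1 ?M0 ?M1.
  by rewrite /score big_bool /= /upd /= /class_mean T0 T1 M0 M1.
- by rewrite /=; lia.
Qed.

Definition candidate_score (k j : 'I_(2 * n)) : R :=
  score R _ (pixel_count k) (gray_sum k)
    (threshold R _ (pixel_count k) (gray_sum k) j).

Lemma pixel_count_ge0 k i : (0 <= pixel_count k i)%R.
Proof. by apply: sumr_ge0 => x _; exact: sumr_ge0. Qed.

Lemma psml_prog_runs s : input_state F s ->
  runs R rs s psml_prog ((10 * KL + 4000) * n ^ 3) (fun s' =>
    exists k j : 'I_(2 * n), let g := threshold R _ (pixel_count k) (gray_sum k) j in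
    [/\ (imem s' 1 0, imem s' 1 1) = opoint n k,
        forall i : 'I_(2 * n), imem s' 2 i = g i :> nat,
        forall b : bool, rmem s' 1 b = class_mean R _ (pixel_count k) (gray_sum k) g b
      & forall k' j', (candidate_score k' j' <= candidate_score k j)%R]).
Proof.
move=> [sn sF].
have n2_gt0 : (0 < 2 * n)%N by rewrite muln_gt0.
(* All pairs lexicographically before [(t, u)] have been tried. The stored score is only bounded by
   that of the stored pair, because its initial value 0 need not be a score; scores being
   nonnegative, the bound holds at the start. *)
pose inv t u s1 := exists k j : 'I_(2 * n), [/\ imem s1 9 0 = k, imem s1 10 0 = j,
  (rmem s1 7 0 <= candidate_score k j)%R
  & forall k' j' : 'I_(2 * n), (k' < t)%N || (k' == t :> nat) && (j' < u)%N ->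
    (candidate_score k' j' <= rmem s1 7 0)%R].
eapply runs_leq; last first.
- apply: runs_seq; apply: runs_rset => _.
  apply: runs_seq; apply: runs_iset => _.
  apply: runs_seq; apply: runs_iset => _.
  apply: runs_seq; apply: runs_weaken (leqnn _) _.
    apply: (runs_for R rs 3 2 _ n ((KL + 300) * n ^ 2 + (2 * n * (300 * n + 100) + 11))
      (fun t => inv t 0%N)) => //.
      exists (Ordinal n2_gt0), (Ordinal n2_gt0); split=> //=.
        by apply: score_ge0 => i; exact: pixel_count_ge0.
      by move=> k' j'; rewrite andbF.
    move=> k s1 k_lt s1k fr inv1.
    pose ko := Ordinal k_lt.
    apply: runs_seq; apply: runs_weaken (leqnn _) _.
      apply: (line_sums_runs s1 k) => //.
      by split=> [|x y]; [rewrite fr.1|rewrite fr.2 //; exact: sF].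
    move=> s2 fr2 [_ s2S s2N] _.
    apply: runs_weaken.
    + apply: (runs_for R rs 4 2 _ n (300 * n + 86) (inv k)) => //.
      * by rewrite fr2.1 // fr.1.
      * rewrite /inv. rewrite !fr2.1 // fr2.2 //.
      move=> j s3 j_lt s3j fr3 inv3.
      pose jo := Ordinal j_lt.
      eapply runs_leq; last first.
      -- apply: runs_seq; apply: runs_weaken (leqnn _) _.
           apply: (split_lines_runs s3 (pixel_count k) (gray_sum k) jo) => //.
           ++ by rewrite fr3.1 // fr2.1 // fr.1.
           ++ by move=> i; rewrite fr3.2.
           ++ by move=> i; rewrite fr3.2.
         move=> s4 fr4 [_ _ s4sc] _.
         have s4k : imem s4 3 0 = k by rewrite fr4.1 // fr3.1 // fr2.1.
         have s4j : imem s4 4 0 = j by rewrite fr4.1.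
         (* A pair tried by the end of this round was tried earlier or is the current one. *)
         have le_split (k' j' : 'I_(2 * n)) :
             (k' < k)%N || (k' == k :> nat) && (j' < j.+1)%N ->
             (k' < k)%N || (k' == k :> nat) && (j' < j)%N \/ k' = ko /\ j' = jo.
           rewrite ltnS (leq_eqVlt j') andb_orr => /or3P[lt|/andP[/eqP kk /eqP jj]|lt].
           - by left; rewrite lt.
           - by right; split; exact: val_inj.
           - by left; rewrite lt orbT.
         have inv4 : inv k j s4.
           by move: inv3; rewrite /inv !fr4.1 // fr4.2.
         case: inv4 => kb [jb [s4kb s4jb best ub]].
         apply: (runs_if R rs _ _ _ _ 20) => /=.
           rewrite -ltNge => lt_best.
           eapply runs_leq; last first.
             apply: runs_seq; apply: runs_rset => _.
             apply: runs_seq; apply: runs_iset => _; apply: runs_iset.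
             exists ko, jo; rewrite /= /upd /= s4k s4j; split=> //.
               by rewrite s4sc.
             move=> k' j' /le_split [/ub le_b|[-> ->]]; last by rewrite s4sc.
             exact: le_trans le_b (ltW lt_best).
           by [].
         rewrite negbK => le_best.
         apply: (runs_leq R rs _ _ 1) => //; apply: runs_skip.
         exists kb, jb; split=> //.
         by move=> k' j' /le_split [/ub //|[-> ->]]; rewrite -[candidate_score _ _]s4sc.
      -- by rewrite /=; lia.
    + by lia.
    (* Having tried all 2n thresholds for [k] amounts to standing at the pair [(k + 1, 0)]. *)
    + move=> s3 fr3 [kb [jb [? ? ? ub]]]; exists kb, jb; split=> //.
      move=> k' j'; rewrite andbF orbF ltnS leq_eqVlt => /orP[kk|kk].
        by apply: ub; rewrite kk ltn_ord orbT.
      by apply: ub; rewrite kk.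
  move=> s1 fr1 [k [j [s1k s1j le_best ub]]] _.
  apply: runs_seq; apply: runs_iset => _.
  apply: runs_seq; apply: runs_weaken (leqnn _) _.
    apply: (line_sums_runs _ k) => //.
    split=> [|x y]; rewrite /= ?/upd /=; first by rewrite fr1.1.
    by rewrite fr1.2 //; exact: sF.
  move=> s2 fr2 [s2O s2S s2N] _.
  apply: runs_seq; apply: runs_iset => _.
  apply: runs_weaken (leqnn _) _.
    apply: (split_lines_runs _ (pixel_count k) (gray_sum k) j) => //=.
    + by rewrite /upd /= fr2.1 //= /upd /= fr1.1.
    + by rewrite /upd /= fr2.1 //= /upd /= s1j.
  move=> s3 fr3 [s3G s3c _]; exists k, j; split=> //.
    by rewrite fr3.1.
  move=> k' j'; apply: le_trans le_best; apply: ub.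
  by rewrite ltn_ord.
- have n3 : (n ^ 3 = n * n * n)%N by rewrite !expnS expn0 muln1 mulnA.
  have n2 : (n ^ 2 = n * n)%N by rewrite !expnS expn0 muln1.
  have le12 : (n <= n * n)%N by nia.
  have le23 : (n * n <= n * n * n)%N by nia.
  have leK : (KL * (n * n) <= KL * (n * n * n))%N by rewrite leq_mul2l le23 orbT.
  by rewrite n3 n2 /=; lia.
Qed.

End Patch.

(** * The mean squared error in terms of weighted lines *)

Section Optimality.
Variables (n : nat) (F : 'M[R]_n).
Hypothesis n_gt0 : (0 < n)%N.
Local Open Scope ring_scope.

Definition pline_ord k (k_lt : (k < 2 * n)%N) x y : 'I_(2 * n) :=
  widen_ord (nlines_le_2n n n_gt0 k k_lt) (line rs (orientation R n n (opoint n k)) x y).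

(** Double counting: every pixel lies in exactly one bucket, that of its own line. *)
Lemma sum_bucket k (k_lt : (k < 2 * n)%N) (w : 'I_(2 * n) -> R)
    (f : 'I_n -> 'I_n -> R) :
  \sum_i w i * bucket R n (pline n k) f i =
  \sum_x \sum_y w (pline_ord k k_lt x y) * f x y.
Proof.
rewrite /bucket; under eq_bigr do rewrite mulr_sumr.
rewrite exchange_big; apply: eq_bigr => x _ /=.
under eq_bigr do rewrite mulr_sumr big_mkcond /=.
rewrite exchange_big; apply: eq_bigr => y _ /=.
rewrite (bigD1 (pline_ord k k_lt x y)) //= eqxx big1 ?addr0 //.
by move=> i; rewrite -val_eqE /= eq_sym => /negbTE ->.
Qed.

Lemma pixel_count_eq0 k i : pixel_count n k i = 0 -> gray_sum n F k i = 0.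
Proof.
move=> N0; apply: big1 => x _; apply: big1 => y xy.
have Nx : \sum_(y' | pline n k x y' == i) 1 = 0 :> R.
  by apply: (psumr_eq0P _ N0) => // x' _; exact: sumr_ge0.
have /eqP : 1 = 0 :> R by apply: (psumr_eq0P _ Nx xy) => *; exact: ler01.
by rewrite oner_eq0.
Qed.

(** Expanding (F - c)^2 separates F^2, common to all parameters, from the cost of the lines. Past
    the last line [g] is arbitrary, as those entries carry no pixel. *)
Lemma mse_psml k (k_lt : (k < 2 * n)%N)
    (G : (nlines rs n n (orientation R n n (opoint n k))).-tuple bool)
    (g : 'I_(2 * n) -> bool) c :
  (forall i, tnth G i = g (widen_ord (nlines_le_2n n n_gt0 k k_lt) i)) ->
  mse F (psml_image G (c false) (c true)) =
  (\sum_x \sum_y F x y ^+ 2 +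
   cost R _ (pixel_count n k) (gray_sum n F k) g c) / (n * n)%:R.
Proof.
move=> Gg; rewrite /mse; congr (_ / _).
rewrite /cost sumrB sumrMnl (sum_bucket k k_lt (fun i => c (g i)) F).
under [X in _ + (X - _)]eq_bigr do rewrite mulrC.
rewrite (sum_bucket k k_lt (fun i => c (g i) ^+ 2) (fun _ _ => 1)).
rewrite -sumrMnl -!sumrB -big_split /=; apply: eq_bigr => x _.
rewrite -sumrMnl -sumrB -big_split /=; apply: eq_bigr => y _.
rewrite mxE Gg -/(pline_ord k k_lt x y); case: (g _) => /=; ring.
Qed.

End Optimality.
End Program.

Theorem theorem1 (R : realType) (rs : raster R) :
  exists (prog : cmd) (K : nat),
  forall (n : nat) (F : 'M[R]_n) (s : state R),
  (0 < n)%N -> input_state F s ->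
  exists (t : nat) (s' : state R) (o : nat * nat)
    (G : (nlines rs n n (orientation R n n o)).-tuple bool) (c1 c2 : R),
  [/\ exec rs s prog t s',
      (t <= K * (n ^ 3 * 2 ^ n))%N,
      output_state s' G c1 c2
    & best_psml F G c1 c2].
Proof.
have [KL KL_bound] := line_time_O1 rs.
exists psml_prog, (10 * KL + 4000)%N => n F s n_gt0 sF.
have [t [s' [run le_t]]] := psml_prog_runs R rs n F KL n_gt0
  (fun o x y => KL_bound n n o x y) s sF.
set N := pixel_count _ _ _; set S := gray_sum _ _ _ _.
case=> k [j]; set g := threshold _ _ _ _ _; case=> s'O s'G s'c best.
have k_in := opoint_in n k n_gt0 (ltn_ord k).
pose widen (l : 'I_(2 * n)) := widen_ord (nlines_le_2n R rs n n_gt0 l (ltn_ord l)).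
pose G := [tuple g (widen k i) | i < nlines rs n n (orientation R n n (opoint n k))].
pose c := class_mean R _ (N k) (S k) g.
exists t, s', (opoint n k), G, (c false), (c true); split=> //.
- apply: leq_trans le_t _; rewrite leq_mul2l; apply/orP; right.
  by rewrite leq_pmulr // expn_gt0.
- split=> //.
  + by move=> i; rewrite tnth_mktuple -s'G.
  + exact: s'c false.
  + exact: s'c true.
split=> // o' G' c1' c2' /(opoint_onto n) [k' o'E]; subst o'.
(* The competing stream is padded with [false] up to length 2n. *)
pose c' b := if b then c2' else c1'; pose g' (i : 'I_(2 * n)) := nth false G' i.
have count_ge0 l i := pixel_count_ge0 R rs n l i.
have gray_eq0 l i := pixel_count_eq0 R rs n F l i.
have [j' le_cost] := threshold_optimal R _ (N k') (S k') (count_ge0 k') (gray_eq0 k')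
  j g' c'.
rewrite (mse_psml R rs n F n_gt0 k (ltn_ord k) G g c); last first.
  by move=> i; rewrite tnth_mktuple.
rewrite (mse_psml R rs n F n_gt0 k' (ltn_ord k') G' g' c'); last first.
  by move=> i; rewrite (tnth_nth false).
(* The common sum of F^2 and the factor 1 / n^2 drop out. The output costs minus its score, which is
   maximal among all candidates, and some candidate at [k'] is at least as good as the
   competitor. *)
rewrite ler_wpM2r ?invr_ge0 // lerD2l cost_mean; [|exact: count_ge0|exact: gray_eq0].
by apply: le_trans le_cost; rewrite lerN2; exact: best.
Qed.
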